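(* Let $0<s<t<1$ be real numbers. For almost all $\alpha\in(s,t)$ and for every $\epsilon>0$, there exists $x_0=x_0(\alpha,s,t,\epsilon)>1$ such that for every $x\geq x_0$, we have $$\#T_{\leq x}(\alpha)\geq (1-t)\min(1-t,\,2s)\,\frac{\log(16x)}{16\log(1+\sqrt{2})+\epsilon}.$$ In particular, $T(\alpha)$ is infinite for almost all $\alpha\in(0,1)$.
   Context: ''Almost all'' is with respect to the $1$-dimensional Lebesgue measure. $\mathbb{N}$ is the set of positive integers; $\lfloor x\rfloor$ is the integer part (floor) of $x$. For $X\subseteq\mathbb{N}$, $T(X)$ is the set of all tuples $(k,\ell,m)\in\mathbb{N}^3$ with $k\leq \ell\leq m$ such that all of $k,\ \ell,\ m,\ k+\ell,\ \ell+m,\ m+k,\ k+\ell+m$ belong to $X$. For $\alpha>0$, let $S(\alpha)=\{\lfloor \alpha n^2\rfloor : n\in\mathbb{N},\ n\geq \alpha^{-1/2}\}$ and $T(\alpha)=T(S(\alpha))$. For $\alpha>0$ and $x>1$, let $T_{\leq x}(\alpha)=\{(\lfloor \alpha n_1^2\rfloor,\lfloor\alpha n_2^2\rfloor,\lfloor\alpha n_3^2\rfloor)\in T(\alpha) : n_1,n_2,n_3\in[\alpha^{-1/2},x]\cap\mathbb{N}\}$. *)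

(* Defs.v *)
From HB Require Import structures.
From mathcomp Require Import all_boot all_order all_algebra finmap.
From mathcomp Require Import all_classical all_reals all_analysis.
Set Implicit Arguments. Unset Strict Implicit. Unset Printing Implicit Defensive.
Import Order.TTheory GRing.Theory Num.Theory.
Local Open Scope classical_set_scope.
Local Open Scope ring_scope.

(* The positive integers are represented inside [nat], with explicit
   positivity conditions.  A triple (k, l, m) is a [nat * nat * nat]. *)

Definition sum_triples (X : set nat) : set (nat * nat * nat) :=
  [set p | let: (k, l, m) := p in
    [/\ (0 < k)%N, (k <= l)%N & (l <= m)%N] /\
    [/\ X k, X l & X m] /\
    [/\ X (k + l)%N, X (l + m)%N, X (m + k)%N & X (k + l + m)%N]].

Section FloorSquares.
Variables (R : realType) (alpha : R).

(* [Num.truncn y] is the floor of [y], as a natural number, when [0 <= y]. *)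
Definition floor_sq (n : nat) : nat := Num.truncn (alpha * n%:R ^+ 2).

Definition admissible : set nat :=
  [set n | (0 < n)%N /\ alpha `^ (- 2^-1) <= n%:R].

Definition S_ : set nat := floor_sq @` admissible.

Definition T_ : set (nat * nat * nat) := sum_triples S_.

(* A set of triples of values: distinct (n1, n2, n3) giving the same triple of
   floors contribute only one element. *)
Definition T_le (x : R) : set (nat * nat * nat) :=
  [set p | T_ p /\ exists n1 n2 n3 : nat,
    [/\ admissible n1 /\ n1%:R <= x, admissible n2 /\ n2%:R <= x,
        admissible n3 /\ n3%:R <= x
      & p = (floor_sq n1, floor_sq n2, floor_sq n3)]].

(* Hence the junk value of [fset_set] on infinite sets never occurs. *)
Lemma finite_T_le (x : R) : finite_set (T_le x).
Proof.
pose F : set nat := `I_(Num.truncn x).+1.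
have nF n : n%:R <= x -> F n.
  by move=> nx; rewrite /F /= ltnS truncn_ge_nat// (le_trans _ nx).
pose g p := (floor_sq p.1.1, floor_sq p.1.2, floor_sq p.2).
apply: (@sub_finite_set _ _ (g @` (F `*` F `*` F))).
  move=> p [_ [n1 [n2 [n3 [[_ /nF h1] [_ /nF h2] [_ /nF h3] ->]]]]].
  by exists (n1, n2, n3).
by apply: finite_image; apply: finite_setX;
  [apply: finite_setX|]; exact: finite_II.
Qed.

End FloorSquares.

(* Main.v *)
Require Import Defs.
From HB Require Import structures.
From mathcomp Require Import all_boot all_order all_algebra finmap.
From mathcomp Require Import all_classical all_reals all_analysis.
From mathcomp Require Import ring lra zify.
Set Implicit Arguments. Unset Strict Implicit. Unset Printing Implicit Defensive.
Import Order.TTheory GRing.Theory Num.Theory.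
Import numFieldNormedType.Exports.
Local Open Scope classical_set_scope.
Local Open Scope ring_scope.

(* Take the Pell solutions [c^2 = 2 a^2 - 1], put [d = (a^2 - 1) / 2], and look
   for triples [(k, k, m)] with [k] and [m] the floors of [alpha a^2] and
   [alpha (d - 1)^2].  The sums [2 a^2], [a^2 + (d - 1)^2] and
   [2 a^2 + (d - 1)^2] exceed the squares of [c], [d] and [d + 1] by only 1, 2
   and 2.  Hence [2 k], [k + m] and [2 k + m] lie in [S_ alpha] as soon as the
   fractional parts of [alpha a^2] and [alpha d^2] lie in a suitable box, of area
   at least [(1 - alpha) min (1 - alpha, 2 alpha) / 4].
   For almost every [alpha] the pairs [(alpha a^2, alpha d^2)] satisfy Weyl's
   criterion: the mean squares over [alpha] of the averaged exponential sums are
   summable along the lengths [j^2], so the averages vanish almost everywhere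
   along these, and then along all lengths.
   Passing to boxes needs no Fourier coefficients: a polynomial in
   [cos^2 (pi (x - c))] approximates the indicator of an interval, and its mean
   along the sequence is asymptotically unchanged by translations, so it can be
   averaged over a fine grid.
   As [d <= (1 + sqrt 2)^(4 n + 2)], about [ln x / (4 ln (1 + sqrt 2))] solutions
   are available below [x]. *)

(** * Mean squares of trigonometric sums *)

Section TurnCosine.
Variable R : realType.
Implicit Types (x y : R) (q : int).

(* Angles are measured in turns, so that [tcos] has period 1. *)
Definition tcos x : R := cos (pi *+ 2 * x).

Lemma tcosDz x q : tcos (x + q%:~R) = tcos x.
Proof.
rewrite /tcos mulrDr.
case: q => n.
  have := periodicn (@cosD2pi R) n (pi *+ 2 * x).
  by rewrite mulr_natr.
rewrite NegzE mulrNz mulrN.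
by rewrite -[LHS](periodicn (@cosD2pi R) n.+1) -[_ *+ n.+1]mulr_natr -pmulrn subrK.
Qed.

Lemma tcosM x y : tcos x * tcos y = (tcos (x - y) + tcos (x + y)) / 2.
Proof. by rewrite /tcos mulrBr mulrDr cosB cosD; field. Qed.

Lemma tcosN x : tcos (- x) = tcos x.
Proof. by rewrite /tcos mulrN cosN. Qed.

(** The sine is the cosine delayed by a quarter turn, so every phase reduces to the two phases [0]
    and [- 4^-1]. *)
Lemma tcosD x y : tcos (x + y) = tcos x * tcos y - tcos (x - 4^-1) * tcos (y - 4^-1).
Proof.
have tsin z : tcos (z - 4^-1) = sin (pi *+ 2 * z).
  rewrite /tcos mulrBr -cosBpihalf; congr (cos (_ - _)).
  by rewrite mulr2n; field.
by rewrite !tsin /tcos mulrDr cosD.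
Qed.

Lemma norm_tcos x : `|tcos x| <= 1. Proof. exact: cos_max. Qed.

Lemma continuous_tcos_affine (c phi : R) :
  continuous (fun x => tcos (c * x + phi)).
Proof.
move=> x; rewrite /tcos.
apply: continuous_comp; last exact: continuous_cos.
apply: cvgM; first exact: cvg_cst.
apply: cvgD; last exact: cvg_cst.
by apply: cvgM; [exact: cvg_cst|exact: cvg_id].
Qed.

Local Notation mu := (@lebesgue_measure R).

Lemma integrable_continuous01 (f : R -> R) : continuous f ->
  mu.-integrable `[0, 1] (EFin \o f).
Proof.
move=> cf; apply: continuous_compact_integrable; first exact: segment_compact.
exact: continuous_subspaceT.
Qed.

(** An integer frequency makes the sine primitive take equal values at [0] and [1]. *)
Lemma integral_tcos q (phi : R) : q != 0 ->
  (\int[mu]_(x in `[0%R, 1%R]) (tcos (q%:~R * x + phi))%:E = 0)%E.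
Proof.
move=> q0.
have q0' : (q%:~R : R) != 0 by rewrite intr_eq0.
have pi0 : (pi : R) *+ 2 != 0 by rewrite lt0r_neq0// mulrn_wgt0 ?pi_gt0.
pose A : R := pi *+ 2 * q%:~R.
have A0 : A != 0 by rewrite mulf_neq0.
pose F x : R := A^-1 * sin (A * x + pi *+ 2 * phi).
have dF (x : R) : is_derive x 1 F (tcos (q%:~R * x + phi)).
  have dG : is_derive x 1 (fun x => A * x + pi *+ 2 * phi) A.
    by apply: is_derive_eq; rewrite /= ?scaler0 ?addr0 ?add0r /GRing.scale/= ?mulr1 ?mulr0 ?addr0.
  have dS := @is_derive1_comp R sin _ x _ _ (is_derive_sin _) dG.
  apply: (@is_derive_eq _ _ _ _ _ _ _ _ (is_deriveZ _ _)).
  rewrite /GRing.scale/= mulrCA mulVf// mulr1 /tcos; congr cos.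
  by rewrite /A; ring.
have cF : continuous F.
  by move=> x; apply/differentiable_continuous/derivable1_diffP; exact: ex_derive.
rewrite (@continuous_FTC2 _ _ F) //.
- rewrite -EFinB; congr EFin; rewrite /F mulr1 mulr0 add0r -mulrBr.
  apply/eqP; rewrite mulf_eq0 subr_eq0; apply/orP; right; apply/eqP.
  rewrite -[LHS]cosBpihalf -[RHS]cosBpihalf.
  have E z : cos (pi *+ 2 * z - pi / 2) = tcos (z - 4^-1).
    by rewrite /tcos mulrBr; congr (cos (_ - _)); rewrite mulr2n; field.
  by rewrite E /A -mulrDr E (addrC q%:~R) addrAC tcosDz.
- by apply: continuous_subspaceT; exact: continuous_tcos_affine.
- split.
  + by move=> x _; exact: ex_derive.
  + exact/cvg_at_right_filter/cF.
  + exact/cvg_at_left_filter/cF.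
- by move=> x _; rewrite derive1E; exact: derive_val.
Qed.
End TurnCosine.

Section MeanSquare.
Variable R : realType.
Local Notation mu := (@lebesgue_measure R).

Lemma integral_tcos_le (q : int) (phi : R) :
  (\int[mu]_(x in `[0%R, 1%R]) (tcos (q%:~R * x + phi))%:E <= ((q == 0)%:R)%:E)%E.
Proof.
have [->|q0] := eqVneq q 0; last by rewrite integral_tcos.
apply: (@le_trans _ _ (\int[mu]_(x in `[0%R, 1%R]) (cst 1%:E x))%E).
  apply: le_integral => //.
  - by apply: integrable_continuous01; exact: continuous_tcos_affine.
  - by apply: (@integrable_continuous01 _ (cst 1)); exact: cst_continuous.
  - by move=> x _; rewrite lee_fin (le_trans (ler_norm _))// norm_tcos.
by rewrite integral_cst//= lebesgue_measure_itv/= lte_fin ltr01 oppr0 adde0 mul1e.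
Qed.

Lemma continuous_tcos_sum (q : nat -> int) (phi : R) N :
  continuous (fun x : R => \sum_(n < N) tcos ((q n)%:~R * x + phi)).
Proof.
elim: N => [|N IHN] x.
  rewrite (_ : (fun _ => _) = cst 0); first exact: cst_continuous.
  by apply/funext => y; rewrite big_ord0.
under eq_fun do rewrite big_ord_recr/=.
by apply: cvgD; [exact: IHN|exact: continuous_tcos_affine].
Qed.

(** The product is half the sum of the waves of frequencies [p - q] and [p + q]; only a vanishing
    frequency contributes, at most one half each. *)
Lemma integral_tcosM_le (p q : int) (phi : R) :
  (\int[mu]_(x in `[0%R, 1%R])
     (tcos (p%:~R * x + phi) * tcos (q%:~R * x + phi))%:E
   <= ((`|p| == `|q|)%:R)%:E)%E.
Proof.
under eq_integral => x _.
  rewrite tcosM mulrC EFinM EFinD.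
  rewrite (_ : _ - _ = (p - q)%:~R * x + 0); last by rewrite intrD mulrNz; ring.
  rewrite (_ : _ + _ + (_ + _) = (p + q)%:~R * x + (phi + phi)); last by rewrite intrD; ring.
  over.
have I (c : int) (psi : R) : mu.-integrable `[0, 1] (EFin \o (fun x => tcos (c%:~R * x + psi))).
  by apply: integrable_continuous01; exact: continuous_tcos_affine.
rewrite integralZl//; last exact: integrableD (I _ _) (I _ _).
rewrite integralD//; try exact: I.
apply: (@le_trans _ _ (2^-1%:E * (((p - q) == 0)%:R%:E + ((p + q) == 0)%:R%:E))%E).
  by rewrite lee_pmul2l ?lte_fin ?invr_gt0//; apply: leeD; exact: integral_tcos_le.
rewrite -EFinD -EFinM lee_fin subr_eq0 addr_eq0.
have [->|pq] := eqVneq p q; first by rewrite eqxx; case: (_ == _) => /=; lra.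
have [->|pq'] := eqVneq p (- q); first by rewrite normrN eqxx /=; lra.
by rewrite addr0 mulr0 ler0n.
Qed.

Lemma integral_tcos_sum_sqr_le (q : nat -> int) (phi : R) N :
  (\int[mu]_(x in `[0%R, 1%R]) ((\sum_(n < N) tcos ((q n)%:~R * x + phi)) ^+ 2)%:E
   <= (\sum_(n < N) \sum_(m < N) (`|q n| == `|q m|)%:R)%:E)%E.
Proof.
under eq_integral => x _.
  rewrite expr2 big_distrlr/= -sumEFin.
  under eq_bigr do rewrite -sumEFin.
  over.
have I n m : mu.-integrable `[0, 1] (EFin \o
   (fun x => tcos ((q n)%:~R * x + phi) * tcos ((q m)%:~R * x + phi))).
  by apply: integrable_continuous01 => x; apply: cvgM; exact: continuous_tcos_affine.
rewrite integral_sum//; last by move=> n; apply: integrable_sum => // m _; exact: I.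
rewrite -sumEFin; apply: lee_sum => n _.
rewrite integral_sum//; last by move=> m; exact: I.
by rewrite -sumEFin; apply: lee_sum => m _; exact: integral_tcosM_le.
Qed.

End MeanSquare.

(** * From mean squares to almost everywhere convergence of averages *)

Section AlmostEverywhere.
Variable R : realType.
Local Notation mu := (@lebesgue_measure R).

Lemma nat_sqrt_ex N : (0 < N)%N -> exists j, (j.+1 ^ 2 <= N < j.+2 ^ 2)%N.
Proof.
elim: N => // -[_ _|N IHN _]; first by exists 0%N.
have [j /andP[h1 h2]] := IHN isT.
have [h|h] := ltnP N.+2 (j.+2 ^ 2); first by exists j; lia.
by exists j.+1; rewrite h/=; lia.
Qed.

(** Going from a square up to [N] below the next one adds at most [2 * j.+1] terms of size at most
    1, negligible against [N >= j.+1 ^ 2]. *)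
Lemma avg_cvg0_squares (c : nat -> R) : (forall n, `|c n| <= 1) ->
  (fun j => (\sum_(n < j.+1 ^ 2) c n) / (j.+1 ^ 2)%:R) @ \oo --> 0 ->
  (fun N => (\sum_(n < N) c n) / N%:R) @ \oo --> 0.
Proof.
move=> c1 /cvgrPdist_le h; apply/cvgrPdist_le => e e0.
have e2 : 0 < e / 2 by rewrite divr_gt0.
have [J _ hJ] := h _ e2.
have [K hK] : exists K : nat, 4 / e <= K%:R.
  by exists (Num.truncn (4 / e)).+1; rewrite ltW// truncnS_gt.
pose L := maxn J K.
exists (L.+1 ^ 2)%N => // N /= LN.
have N0 : (0 < N)%N by rewrite (leq_trans _ LN)// expn_gt0.
have [j /andP[j1 j2]] := nat_sqrt_ex N0.
have Lj : (L <= j)%N.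
  by move: (leq_ltn_trans LN j2); rewrite ltn_exp2r.
have := hJ j (leq_trans (leq_maxl _ _) Lj).
rewrite !sub0r !normrN !normrM !normfV !normr_nat.
rewrite ler_pdivrMr ?ltr0n ?expn_gt0// ler_pdivrMr ?ltr0n// => hj.
have -> : \sum_(n < N) c n = \sum_(n < j.+1 ^ 2) c n + \sum_(j.+1 ^ 2 <= n < N) c n.
  by rewrite -!(big_mkord xpredT) -big_cat_nat.
apply: (le_trans (ler_normD _ _)).
have h2 : `|\sum_(j.+1 ^ 2 <= n < N) c n| <= (N - j.+1 ^ 2)%:R.
  apply: (le_trans (ler_norm_sum _ _ _)).
  rewrite -[leRHS]mulr1 mulr_natl -sumr_const_nat; exact: ler_sum.
have h3 : (N - j.+1 ^ 2)%:R <= 2 * (j.+1)%:R :> R.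
  by rewrite -natrM ler_nat; lia.
have h4 : 4 / e <= j.+1%:R.
  by rewrite (le_trans hK)// ler_nat; lia.
rewrite ler_pdivrMr// in h4.
have h5 : (j.+1 ^ 2)%:R <= N%:R :> R by rewrite ler_nat.
have h6 : 4 * j.+1%:R <= e * (j.+1 ^ 2)%:R.
  by rewrite natrX expr2 mulrA [e * _]mulrC ler_wpM2r.
have h7 : e * (j.+1 ^ 2)%:R <= e * N%:R by rewrite ler_wpM2l// ltW.
lra.
Qed.

(** Along the lengths [j.+1 ^ 2] the squared averages have a summable sequence of integrals. Their
    sum is thus finite almost everywhere, which forces its terms to tend to 0. *)
Lemma ae_tcos_avg_cvg0 (q : nat -> int) (phi C : R) :
  (forall N, \sum_(n < N) \sum_(m < N) (`|q n| == `|q m|)%:R <= C * N%:R) ->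
  {ae mu, forall x, `[0%R, 1%R]%classic x ->
    (fun N => (\sum_(n < N) tcos ((q n)%:~R * x + phi)) / N%:R) @ \oo --> (0 : R)}.
Proof.
move=> hC.
have C0 : 0 <= C.
  have := hC 1%N; rewrite mulr1; apply: le_trans.
  by apply: sumr_ge0 => n _; apply: sumr_ge0.
pose S N x := \sum_(n < N) tcos ((q n)%:~R * x + phi).
pose g j x : R := (S (j.+1 ^ 2)%N x / (j.+1 ^ 2)%:R) ^+ 2.
have cS N : continuous (S N) by exact: continuous_tcos_sum.
have cg j : continuous (g j).
  by move=> x; rewrite /g; under eq_fun do rewrite expr2;
    apply: cvgM; apply: cvgM (cS _ _) (cvg_cst _).
(* The integral is at most [C / j.+1 ^ 2]; the bound is written as a telescoping difference, which
   keeps the partial sums below [C * 2]. *)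
have ig j : (\int[mu]_(x in `[0%R, 1%R]) (g j x)%:E <= (C * (2 * (j.+1%:R^-1 - j.+2%:R^-1)))%:E)%E.
  under eq_integral => x _.
    rewrite /g expr_div_n mulrC EFinM; over.
  rewrite integralZl//; last first.
    apply: (@integrable_continuous01 _ (fun x => S (j.+1 ^ 2)%N x ^+ 2)) => x.
    by under eq_fun do rewrite expr2; apply: cvgM (cS _ _) (cS _ _).
  apply: (@le_trans _ _ (((j.+1 ^ 2)%:R ^+ 2)^-1%:E * (C * (j.+1 ^ 2)%:R)%:E)%E).
    apply: lee_wpmul2l; first by rewrite lee_fin invr_ge0 exprn_ge0.
    by apply: (le_trans (integral_tcos_sum_sqr_le _ _ _)); rewrite lee_fin.
  rewrite -EFinM lee_fin mulrCA; apply: ler_wpM2l => //.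
  rewrite natrX -exprM.
  have j1 : (0 : R) < j.+1%:R by [].
  have -> : j.+2%:R = j.+1%:R + 1 :> R by rewrite -natr1.
  have j2 : (1 : R) <= j.+1%:R by rewrite ler1n.
  move: (j.+1%:R) j1 j2 => y y0 y1.
  rewrite (_ : (y ^+ (2 * 2))^-1 * y ^+ 2 = (y ^+ 2)^-1); last by field; rewrite lt0r_neq0.
  rewrite (_ : 2 * _ = 2 / (y * (y + 1))); last by field; rewrite !lt0r_neq0 // addr_gt0.
  by rewrite ler_pdivlMr ?mulr_gt0 ?addr_gt0// mulrC ler_pdivrMr ?exprn_gt0//; nra.
have mg j := measurable_int mu (integrable_continuous01 (cg j)).
have g0 j x : 0 <= g j x by exact: sqr_ge0.
pose F x := (\sum_(j <oo) (g j x)%:E)%E.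
have iF : mu.-integrable `[0%R, 1%R] F.
  apply/integrableP; split.
    rewrite /F; apply: (@ge0_emeasurable_sum _ _ _ _ (fun j x => (g j x)%:E) xpredT) => //.
      by move=> k x _ _; rewrite lee_fin.
    by move=> k _; exact: mg.
  under eq_integral => x _.
    rewrite gee0_abs; last by apply: nneseries_ge0 => n _ _; rewrite lee_fin.
    over.
  rewrite integral_nneseries//; last by move=> n x _; rewrite lee_fin.
  apply: (@le_lt_trans _ _ (C * 2)%:E); last by rewrite ltry.
  apply: lime_le.
    by apply: is_cvg_nneseries => n _ _; apply: integral_ge0 => x _; rewrite lee_fin.
  apply: nearW => n.
  apply: (@le_trans _ _ (\sum_(0 <= i < n) (C * (2 * (i.+1%:R^-1 - i.+2%:R^-1)))%:E)%E).
    by apply: lee_sum => i _; exact: ig.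
  rewrite sumEFin lee_fin -mulr_sumr -mulr_sumr ler_wpM2l// -[leRHS]mulr1 ler_wpM2l//.
  rewrite (@telescope_sumr_eq _ 0 n (fun i => - i.+1%:R^-1)) //.
    by rewrite invr1 opprK addrC lerBlDr lerDl invr_ge0.
  by move=> i _; rewrite opprK addrC.
have mI : measurable (`[0%R, 1%R]%classic : set (measurableTypeR R)) by exact: measurable_itv.
have := integrable_ae mI iF.
apply: filterS => x Fx x01.
apply: (@avg_cvg0_squares (fun n => tcos ((q n)%:~R * x + phi))).
  by move=> n; exact: norm_tcos.
have := Fx x01 => Fxfin.
have cvgg : (g ^~ x) @ \oo --> 0.
  apply: cvg_series_cvg_0; apply: nondecreasing_is_cvgn.
    by apply/nondecreasing_seqP => n; rewrite /series/= big_nat_recr//= lerDl.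
  exists (fine (F x)) => _ [n _ <-].
  rewrite -lee_fin fineK// /series/= -sumEFin.
  by apply: (@nneseries_lim_ge _ (fun j => (g j x)%:E) xpredT) => i _ _; rewrite lee_fin.
apply/cvgrPdist_le => e e0.
move/cvgrPdist_le : cvgg => /(_ _ (exprn_gt0 2 e0)); apply: filterS => j.
rewrite !sub0r !normrN (ger0_norm (g0 _ _)) /g => h.
by rewrite -(@ler_pXn2r _ 2) ?nnegrE ?(ltW e0)// real_normK ?num_real.
Qed.
End AlmostEverywhere.

(** * Equidistribution of the Pell squares *)

(* The positive solutions [(a, c)] of [c ^ 2 = 2 * a ^ 2 - 1]: they satisfy
   [c + a * sqrt 2 = (1 + sqrt 2) ^ (2 * n + 1)], and [a] is odd. *)
Fixpoint pell n : nat * nat :=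
  if n is m.+1 then let: (a, c) := pell m in (2 * c + 3 * a, 3 * c + 4 * a)%N
  else (1, 1)%N.
Definition pell_a n := (pell n).1.
Definition pell_c n := (pell n).2.
Definition pell_d n := (pell_a n ^ 2)./2.

Lemma pell_aS n : pell_a n.+1 = (2 * pell_c n + 3 * pell_a n)%N.
Proof. by rewrite /pell_a /pell_c /=; case: (pell n). Qed.

Lemma pell_cS n : pell_c n.+1 = (3 * pell_c n + 4 * pell_a n)%N.
Proof. by rewrite /pell_a /pell_c /=; case: (pell n). Qed.

Lemma pell_eq n : (pell_c n ^ 2 + 1 = 2 * pell_a n ^ 2)%N.
Proof. by elim: n => // n IHn; rewrite pell_aS pell_cS; nia. Qed.

Lemma odd_pell_a n : odd (pell_a n).
Proof. by elim: n => // n IHn; rewrite pell_aS oddD !oddM IHn. Qed.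

Lemma pell_dE n : (pell_a n ^ 2 = 2 * pell_d n + 1)%N.
Proof.
have := odd_double_half (pell_a n ^ 2).
by rewrite oddX odd_pell_a orbT -mul2n addnC => <-.
Qed.

Lemma pell_a_le_c n : (pell_a n <= pell_c n)%N.
Proof. by case: n => // n; rewrite pell_aS pell_cS; lia. Qed.

Lemma ltn_pell_a n : (n < pell_a n)%N.
Proof.
by elim: n => // n IHn; rewrite pell_aS; have := pell_a_le_c n; lia.
Qed.

Lemma leq_pell_d n : (n <= pell_d n)%N.
Proof. by have := pell_dE n; have := ltn_pell_a n; nia. Qed.

Lemma ltn_pell_d m n : (m < n)%N -> (pell_d m < pell_d n)%N.
Proof.
apply: (homo_ltn ltn_trans) => {}n; have := pell_dE n; have := pell_dE n.+1.
by rewrite pell_aS; have := pell_a_le_c n; have := ltn_pell_a n; nia.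
Qed.

Definition pell_freq (h k : int) n : int :=
  h * (pell_a n ^ 2)%:Z + k * (pell_d n ^ 2)%:Z.

(** Since [a ^ 2 = 2 * d + 1], the frequency is the polynomial [k * d ^ 2 + 2 * h * d + h] in [d].
    Its absolute value is injective on the integers [d >= 2 * absz h + 2]. *)
Lemma pell_freq_norm_inj (h k : int) m n : (h, k) != (0, 0) ->
  (2 * absz h + 2 <= m)%N -> (2 * absz h + 2 <= n)%N ->
  `|pell_freq h k m| = `|pell_freq h k n| -> m = n.
Proof.
move=> hk hm hn.
wlog mn : m n hm hn / (m <= n)%N.
  by case: (leqP m n) => [mn|/ltnW nm] W E; [exact: W|symmetry; apply: W].
case: (ltngtP m n) mn => // mn _ /eqP.
have d1 := leq_trans hm (leq_pell_d m).
have d2 : (pell_d m < pell_d n)%N by exact: ltn_pell_d.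
rewrite eqr_norm2 /pell_freq !pell_dE.
move: (pell_d m) (pell_d n) d1 d2 => d e d1 d2.
have kh : k != 0 \/ k = 0 /\ h != 0.
  by move: hk; rewrite xpair_eqE; case: (eqVneq k 0) => [->|]; [rewrite andbT; right|left].
have hH : - (absz h)%:Z <= h <= (absz h)%:Z by lia.
move: (absz h) hH d1 {hm hn} => H hH d1 E; exfalso.
have [D [F [ED EF D1 F1]]] : exists D F : int, [/\ D = d%:Z, F = e%:Z, 2 * H%:Z + 2 <= D & D < F].
  by exists d%:Z, e%:Z; split => //; lia.
have lin (x : nat) : (2 * x + 1)%N%:Z = 2 * x%:Z + 1 by lia.
have sqr (x : nat) : (x ^ 2)%N%:Z = x%:Z * x%:Z by rewrite expnS expn1 PoszM.
move: E; rewrite !lin !sqr -ED -EF {lin sqr} => /orP[] /eqP E.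
  (* Equal signs: the difference of the two values factors, and neither factor can vanish. *)
  have : (D - F) * (k * (D + F) + 2 * h) = 0.
    by apply/eqP; rewrite -subr_eq0; apply/eqP; move: E; lia.
  move/eqP; rewrite mulf_eq0 => /orP[|/eqP] E'; first by lia.
  case: kh => [k0|[k0 h0]]; last by subst k; lia.
  have : 1 <= k \/ k <= -1 by lia.
  by case; nia.
case: kh => [k0|[k0 h0]].
  (* Opposite signs: the two values add up to zero, yet for nonzero [k] the sum of squares outweighs
     the term in [h]. *)
  have E' : k * (D * D + F * F) + 2 * h * (D + F + 1) = 0 by lia.
  have DF : 2 * H%:Z * (D + F + 1) < D * D + F * F by nia.
  have hb : - (2 * H%:Z * (D + F + 1)) <= 2 * h * (D + F + 1) <= 2 * H%:Z * (D + F + 1) by nia.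
  have : 1 <= k \/ k <= -1 by lia.
  by case; nia.
have : h * (D + F + 1) = 0 by subst k; lia.
by move/eqP; rewrite mulf_eq0 (negbTE h0) /= => /eqP; lia.
Qed.

Section PellWeyl.
Variable R : realType.
Local Notation mu := (@lebesgue_measure R).

Lemma sum_ltn_le n0 N : (\sum_(n < N) (n < n0) <= n0)%N.
Proof.
suff -> : (\sum_(n < N) (n < n0) = minn N n0)%N by rewrite geq_minr.
elim: N => [|N IHN]; first by rewrite big_ord0 min0n.
by rewrite big_ord_recr/= IHN; case: ltnP; lia.
Qed.

(** A coincidence off the diagonal involves an index below [n0], and at most [2 * n0 * N] pairs
    do. *)
Lemma sum_eq_le_eventually_inj (E : nat -> nat -> bool) n0 N :
  (forall m n, (n0 <= m)%N -> (n0 <= n)%N -> E m n -> m = n) ->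
  \sum_(n < N) \sum_(m < N) (E n m)%:R <= (2 * n0 + 1)%:R * N%:R :> R.
Proof.
move=> inj.
apply: (@le_trans _ _ (\sum_(n < N) \sum_(m < N) ((n < n0) + (m < n0) + (n == m)))%N%:R).
  rewrite natr_sum; apply: ler_sum => n _; rewrite natr_sum; apply: ler_sum => m _.
  rewrite ler_nat; have [hn|hn] := ltnP n n0; first by case: (E n m).
  have [hm|hm] := ltnP m n0; first by case: (E n m).
  case Enm : (E n m) => //; have := inj _ _ hn hm Enm.
  by move/ord_inj => ->; rewrite eqxx.
rewrite -natrM ler_nat.
have -> : (\sum_(n < N) \sum_(m < N) ((n < n0) + (m < n0) + (n == m)) =
  N * (\sum_(n < N) (n < n0)) + N * (\sum_(n < N) (n < n0)) + N)%N.
  transitivity (\sum_(n < N) (N * (n < n0) + (\sum_(m < N) (m < n0)) + 1))%N.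
    apply: eq_bigr => n _; rewrite !big_split/= sum_nat_const card_ord.
    congr (_ + _)%N; rewrite (bigD1 n)//= eqxx big1 ?addn0// => m.
    by rewrite eq_sym => /negbTE ->.
  rewrite !big_split/= -big_distrr/= !sum_nat_const card_ord muln1.
  by [].
by have := sum_ltn_le n0 N; nia.
Qed.

(** Real form of Weyl's criterion for pairs modulo 1: a free phase [phi] replaces the complex
    exponential. *)
Definition weyl (x y : nat -> R) := forall (h k : int) (phi : R), (h, k) != (0, 0) ->
  (fun N => (\sum_(n < N) tcos (h%:~R * x n + k%:~R * y n + phi)) / N%:R) @ \oo --> 0.

Lemma ae_weyl_pell : {ae mu, forall alpha, `[0%R, 1%R]%classic alpha ->
  weyl (fun n => alpha * (pell_a n)%:R ^+ 2) (fun n => alpha * (pell_d n)%:R ^+ 2)}.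
Proof.
have H (h k : int) phi : (h, k) != (0, 0) ->
    {ae mu, forall x, `[0%R, 1%R]%classic x ->
    (fun N => (\sum_(n < N) tcos ((pell_freq h k n)%:~R * x + phi)) / N%:R) @ \oo --> (0 : R)}.
  move=> hk; apply: (@ae_tcos_avg_cvg0 _ _ _ (2 * (2 * absz h + 2) + 1)%:R) => N.
  apply: (@sum_eq_le_eventually_inj (fun n m =>
    `|pell_freq h k n| == `|pell_freq h k m|)) => m n hm hn /eqP.
  exact: pell_freq_norm_inj hk hm hn.
(* The phases are uncountable, so only [0] and [- 4^-1] are kept, and the pairs [(h, k)] are
   enumerated through [unpickle]: countably many null sets remain. *)
pose P (i : nat) (x : R) := `[0%R, 1%R]%classic x ->
  if @choice.unpickle (int * int)%type i is Some (h, k) then (h, k) != (0, 0) ->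
    forall b : bool, (fun N =>
      (\sum_(n < N) tcos ((pell_freq h k n)%:~R * x + (if b then 0 else - 4^-1)))
        / N%:R) @ \oo --> (0 : R) else True.
have HP i : {ae mu, forall x, P i x}.
  rewrite /P; case: (choice.unpickle i) => [[h k]|]; last exact: aeW.
  have [hk0|hk] := eqVneq (h, k) (0, 0).
    by apply: aeW.
  have := H _ _ 0 hk; have := H _ _ (- 4^-1) hk.
  by apply: (filterS2 (ae_filter_ringOfSetsType mu)) => x h1 h2 x01 _ [|]; [exact: h2|exact: h1].
have := ae_foralln HP.
apply: filterS => x Px x01 h k phi hk.
have := Px (choice.pickle (h, k)) x01; rewrite choice.pickleK => /(_ hk) C.
have fE n : h%:~R * (x * (pell_a n)%:R ^+ 2) + k%:~R * (x * (pell_d n)%:R ^+ 2)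
   = (pell_freq h k n)%:~R * x.
  by rewrite /pell_freq intrD !intrM -!(pmulrn 1) !natrX; ring.
rewrite (_ : (fun _ => _) = (fun N =>
   tcos phi * ((\sum_(n < N) tcos ((pell_freq h k n)%:~R * x + 0)) / N%:R)
   - tcos (phi - 4^-1) *
     ((\sum_(n < N) tcos ((pell_freq h k n)%:~R * x - 4^-1)) / N%:R))); last first.
  apply/funext => N; rewrite !mulrA -mulrBl; congr (_ / _).
  rewrite !mulr_sumr -sumrB; apply: eq_bigr => n _.
  by rewrite fE addr0 (tcosD _ phi); ring.
rewrite -[X in _ --> X](_ : tcos phi * 0 - tcos (phi - 4^-1) * 0 = 0); last by rewrite !mulr0 subr0.
by apply: cvgB; apply: cvgM; [exact: cvg_cst|exact: (C true)|exact: cvg_cst|exact: (C false)].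
Qed.
End PellWeyl.

(** * Frequencies of boxes *)

Section Equidistribution.
Variable R : realType.

(** Real trigonometric polynomials in two variables: the free phases supply the sines, and the
    character with [h = k = 0] the constants. *)
Inductive trig_poly : (R -> R -> R) -> Prop :=
| trig_char (h k : int) (phi : R) :
    trig_poly (fun x y => tcos (h%:~R * x + k%:~R * y + phi))
| trig_lin (a b : R) F G : trig_poly F -> trig_poly G ->
    trig_poly (fun x y => a * F x y + b * G x y).

Lemma eq_trig_poly F G : (forall x y, F x y = G x y) -> trig_poly F -> trig_poly G.
Proof.
move=> FG; suff -> : F = G by [].
by apply/funext => x; apply/funext => y.
Qed.

Lemma trig_polyM F G : trig_poly F -> trig_poly G ->
  trig_poly (fun x y => F x y * G x y).
Proof.
move=> tF tG; elim: tF => [h k phi|a b F1 F2 _ IH1 _ IH2].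
  elim: tG => [h' k' phi'|a b G1 G2 _ IH1 _ IH2].
    apply: eq_trig_poly (trig_lin 2^-1 2^-1
      (trig_char (h - h') (k - k') (phi - phi')) (trig_char (h + h') (k + k') (phi + phi'))).
    move=> x y; rewrite tcosM mulrDl !(mulrC (tcos _)).
    by congr (_ * tcos _ + _ * tcos _); rewrite ?(intrD, mulrNz); ring.
  by apply: eq_trig_poly (trig_lin a b IH1 IH2) => x y; ring.
by apply: eq_trig_poly (trig_lin a b IH1 IH2) => x y; ring.
Qed.

Lemma trig_poly_cst (c : R) : trig_poly (fun _ _ => c).
Proof.
apply: eq_trig_poly (trig_lin c 0 (trig_char 0 0 0) (trig_char 0 0 0)) => x y.
by rewrite !mul0r !addr0 /tcos mulr0 cos0 mulr1.
Qed.

Lemma trig_polyX F n : trig_poly F -> trig_poly (fun x y => F x y ^+ n).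
Proof.
move=> tF; elim: n => [|n IHn]; first exact: trig_poly_cst.
by apply: eq_trig_poly (trig_polyM tF IHn) => x y; rewrite exprS.
Qed.

Lemma trig_poly_swap F : trig_poly F -> trig_poly (fun x y => F y x).
Proof.
elim=> [h k phi|a b F1 F2 _ IH1 _ IH2]; last exact: trig_lin.
by apply: eq_trig_poly (trig_char k h phi) => x y; rewrite (addrC (k%:~R * x)).
Qed.

Lemma bernoulli_ge (v : R) n : -1 <= v -> 1 + n%:R * v <= (1 + v) ^+ n.
Proof.
move=> v1; elim: n => [|n IHn]; first by rewrite expr0 mul0r addr0.
have n0 : 0 <= n%:R :> R by [].
have : (1 + n%:R * v) * (1 + v) <= (1 + v) ^+ n * (1 + v) by rewrite ler_wpM2r// -lerBlDl sub0r.
by rewrite exprSr -natr1; nra.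
Qed.

(* [1 - (1 - u ^ n) ^ M] jumps from 0 to 1 near [u = M ^ (- 1 / n)]. *)
Lemma bump_exponents (u0 u1 delta : R) : 0 <= u0 -> u0 < u1 -> u1 <= 1 -> 0 < delta ->
  exists n M : nat, forall u, 0 <= u <= 1 ->
    [/\ u <= u0 -> 1 - (1 - u ^+ n) ^+ M <= delta &
        u1 <= u -> (1 - u ^+ n) ^+ M <= delta].
Proof.
move=> u00 u01 u11 d0.
have u10 : 0 < u1 by exact: le_lt_trans u01.
pose r := u0 / u1.
have r0 : 0 <= r by rewrite divr_ge0// ltW.
have r1 : r < 1 by rewrite ltr_pdivrMr// mul1r.
(* First [n] makes [r ^+ n] tiny; then [M], about [(delta * u1 ^+ n)^-1], makes [M * u ^ n] at most
   [delta] for [u <= u0] and at least [delta^-1] for [u >= u1]. *)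
have [n hn] : exists n, r ^+ n * (delta^-1 + 1) <= delta.
  have e0 : 0 < delta / (delta^-1 + 1) by rewrite divr_gt0// addr_gt0 ?invr_gt0.
  have : (fun n => r ^+ n) @ \oo --> 0 by apply: cvg_expr; rewrite ger0_norm.
  move/cvgrPdist_le => /(_ _ e0) [n _ /(_ n (leqnn _))]/=.
  rewrite sub0r normrN ger0_norm ?exprn_ge0// ler_pdivlMr ?addr_gt0 ?invr_gt0// => h.
  by exists n.
have p0 : 0 < delta * u1 ^+ n by rewrite mulr_gt0// exprn_gt0.
pose M := (Num.truncn (delta * u1 ^+ n)^-1).+1.
have M1 : (delta * u1 ^+ n)^-1 <= M%:R by rewrite ltW// truncnS_gt.
have M2 : M%:R <= (delta * u1 ^+ n)^-1 + 1.
  by rewrite -natr1 lerD2r truncn_le// invr_ge0 ltW.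
exists n, M => u /andP[uge ule].
have un0 : 0 <= u ^+ n by rewrite exprn_ge0.
have un1 : u ^+ n <= 1 by rewrite exprn_ile1.
split=> hu.
  have h1 : u ^+ n <= u0 ^+ n by rewrite lerXn2r.
  have h2 : M%:R * u ^+ n <= delta.
    apply: (le_trans _ hn).
    apply: (@le_trans _ _ (((delta * u1 ^+ n)^-1 + 1) * u0 ^+ n)).
      by apply: ler_pM.
    rewrite mulrDl mulrDr mul1r mulr1 lerD//.
      by rewrite /r expr_div_n invfM mulrC -mulrA (mulrC _^-1) mulrA.
    rewrite /r expr_div_n ler_pdivlMr ?exprn_gt0//.
    by rewrite ler_piMr ?exprn_ge0// exprn_ile1// ltW.
  have := @bernoulli_ge (- u ^+ n) M; rewrite lerN2 => /(_ un1).
  by rewrite mulrN; lra.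
have h1 : u1 ^+ n <= u ^+ n by rewrite lerXn2r// ?nnegrE ltW.
have h2 : delta^-1 <= M%:R * u ^+ n.
  apply: (@le_trans _ _ ((delta * u1 ^+ n)^-1 * u1 ^+ n)).
    by rewrite invfM -mulrA mulVf ?mulr1// gt_eqF// exprn_gt0.
  by apply: ler_pM => //; [rewrite invr_ge0 ltW|rewrite exprn_ge0 ?ltW].
(* By Bernoulli's inequality the second factor is at least [delta^-1], so the first is at most
   [delta]. *)
have h3 : (1 - u ^+ n) ^+ M * (1 + u ^+ n) ^+ M <= 1.
  by rewrite -exprMn exprn_ile1//; nra.
have h4 := @bernoulli_ge (u ^+ n) M (le_trans (lerN10 _) un0).
have h5 : 0 <= (1 - u ^+ n) ^+ M by rewrite exprn_ge0// subr_ge0.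
have h6 : (1 - u ^+ n) ^+ M * delta^-1 <= 1.
  apply: le_trans h3; by apply: ler_wpM2l => //; lra.
by move: h6; rewrite ler_pdivrMr// mul1r.
Qed.

Lemma tcos_norm (t : R) : tcos `|t| = tcos t.
Proof. by case: (ger0P t) => // _; rewrite tcosN. Qed.

Lemma ltr_tcos (s t : R) : 0 <= s -> s < t -> t <= 2^-1 -> tcos t < tcos s.
Proof.
move=> s0 st t2.
have pi0 : 0 < pi *+ 2 :> R by rewrite mulrn_wgt0// pi_gt0.
have B (u : R) : 0 <= u <= 2^-1 -> pi *+ 2 * u \in `[0, pi].
  move=> /andP[u0 u1]; rewrite in_itv/= pmulr_rge0// u0/=.
  by rewrite -[_ *+ 2]mulr_natr -mulrA ler_piMr ?pi_ge0//; lra.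
have s2 : 0 <= s <= 2^-1 by apply/andP; split => //; lra.
have t0 : 0 <= t <= 2^-1 by apply/andP; split => //; lra.
by rewrite /tcos ltr_cos ?B// ltr_pM2l.
Qed.

Lemma ler_tcos (s t : R) : 0 <= s -> s <= t -> t <= 2^-1 -> tcos t <= tcos s.
Proof.
by move=> s0; rewrite le_eqVlt => /predU1P[->//|st t2]; exact/ltW/ltr_tcos.
Qed.

(** Modulo 1, more than [K * w - 1] points of a grid of step [1 / K] fall in an interval of length
    [w]. Each contributes at least [v], the others at least 0. *)
Lemma grid_avg_ge (P : R -> R) (a w v : R) (K : nat) : (0 < K)%N ->
  (forall x (z : int), P (x + z%:~R) = P x) -> (forall x, 0 <= P x) ->
  0 <= v -> 0 <= w <= 1 -> (forall x, a <= x <= a + w -> v <= P x) ->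
  forall x, v * (w - K%:R^-1) <= (\sum_(i < K) P (x + i%:R / K%:R)) / K%:R.
Proof.
move=> K0 perP P0 v0 /andP[w0 w1] hv x.
have K0' : 0 < K%:R :> R by rewrite ltr0n.
pose H y := \sum_(i < K) P (y + i%:R / K%:R).
have H1 y : H (y + K%:R^-1) = H y.
  rewrite /H; case: K K0 K0' {H} => // k _ k0.
  rewrite big_ord_recr [RHS]big_ord_recl/= mul0r addr0 addrC; congr (_ + _).
    rewrite -addrA -[X in _ + (X + _)]mul1r -mulrDl -[1 + _]addrC natr1 divff ?gt_eqF//.
    exact: perP y 1.
  apply: eq_bigr => i _; congr P.
  by rewrite -addrA; congr (_ + _); rewrite -[X in X + _]mul1r -mulrDl nat1r.
have Hn n y : H (y + n%:R / K%:R) = H y.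
  elim: n y => [|n IH] y; first by rewrite mul0r addr0.
  by rewrite -natr1 mulrDl mul1r addrA H1 IH.
have Hz (z : int) y : H (y + z%:~R / K%:R) = H y.
  case: z => n; first exact: Hn.
  by rewrite NegzE mulrNz mulNr -[LHS](Hn n.+1) subrK.
(* Steps of [1 / K] permute the grid modulo 1, so its first point [y] may be moved into
   [[a, a + 1 / K)]; the first [L] points then stay in [[a, a + w]]. *)
pose t : int := - Num.floor (K%:R * (x - a)).
pose y := x + t%:~R / K%:R.
have Ky : K%:R * (y - a) = K%:R * (x - a) + t%:~R.
  by rewrite /y; field; rewrite gt_eqF.
have yge : 0 <= K%:R * (y - a).
  by rewrite Ky /t mulrNz subr_ge0 floor_le_tmp.
have ylt : K%:R * (y - a) < 1.
  by rewrite Ky /t mulrNz; have := floorD1_gt (K%:R * (x - a)); rewrite intrD; lra.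
rewrite -/(H x) -(Hz t x) -/y ler_pdivlMr//.
rewrite mulrBr mulrBl -(mulrA v K%:R^-1) mulVf ?mulr1 ?gt_eqF//.
pose L := Num.truncn (K%:R * w).
have L1 : K%:R * w < L%:R + 1 by rewrite natr1 truncnS_gt.
have L2 : L%:R <= K%:R * w by rewrite truncn_le// mulr_ge0// ltW.
have LK : (L <= K)%N by rewrite -(ler_nat R) (le_trans L2)// ler_piMr// ltW.
apply: (@le_trans _ _ (L%:R * v)); first by nra.
rewrite /H -(big_mkord xpredT (fun i => P (y + i%:R / K%:R))) (@big_cat_nat _ _ _ L)//=.
rewrite -[leLHS]addr0 lerD ?sumr_ge0//.
rewrite mulr_natl -[X in _ *+ X]subn0 -sumr_const_nat.
apply: ler_sum_nat => i /andP[_ iL]; apply: hv.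
have E : y + i%:R / K%:R - a = (K%:R * (y - a) + i%:R) / K%:R.
  by field; rewrite gt_eqF.
rewrite -subr_ge0 E divr_ge0 ?addr_ge0 ?(ltW K0')//=.
rewrite -lerBlDl E ler_pdivrMr//.
have : i.+1%:R <= L%:R :> R by rewrite ler_nat.
by rewrite -natr1; lra.
Qed.

(** On the circle, [cos^2 (pi (x - c))] decreases with the distance to the midpoint [c], so a steep
    polynomial in it isolates the interval. Grid averages stand in for the integral of [P]. *)
Lemma interval_bump (a b rho delta : R) :
  a < b -> b <= a + 1 -> 0 <= rho -> rho < b - a -> 0 < delta ->
  exists P : R -> R, [/\ trig_poly (fun x y => P x), (forall x, 0 <= P x <= 1),
    (forall x, (forall z : int, ~ (a < x - z%:~R < b)) -> P x <= delta) &
    exists2 K, (0 < K)%N & forall x, rho <= (\sum_(i < K) P (x + i%:R / K%:R)) / K%:R].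
Proof.
move=> ab b1 rho0 rhol d0.
pose c := (a + b) / 2; pose r := (b - a) / 2.
(* The bump is near 1 within [r'] of [c], where [rho < 2 * r' < b - a]. The surplus [2 * r' - rho]
   is shared equally by the height defect [e] and the grid step [1 / K]. *)
pose r' := (r + rho / 2) / 2.
have r'0 : 0 < r' by rewrite /r' /r; lra.
have r'r : r' < r by rewrite /r' /r; lra.
have r2 : r <= 2^-1 by rewrite /r; lra.
pose e := Num.min delta ((2 * r' - rho) / 2).
have g0 : 0 < (2 * r' - rho) / 2 by rewrite /r' /r; lra.
have e0 : 0 < e by rewrite lt_min d0.
pose u x := (1 + tcos (x - c)) / 2.
have tc (x : R) : -1 <= tcos x <= 1 by rewrite -ler_norml norm_tcos.
have u01 x : 0 <= u x <= 1.
  by rewrite /u; have := tc (x - c); move=> /andP[]; lra.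
have [||||n [M hM]] := @bump_exponents ((1 + tcos r) / 2) ((1 + tcos r') / 2) e.
- by have := tc r; move=> /andP[]; lra.
- by have := ltr_tcos (ltW r'0) r'r r2; lra.
- by have := tc r'; move=> /andP[]; lra.
- by [].
pose P x := 1 - (1 - u x ^+ n) ^+ M.
have P01 x : 0 <= P x <= 1.
  have /andP[ua ub] := u01 x.
  have v1 : 0 <= u x ^+ n by rewrite exprn_ge0.
  have v2 : u x ^+ n <= 1 by rewrite exprn_ile1.
  have w1 : 0 <= (1 - u x ^+ n) ^+ M by rewrite exprn_ge0// subr_ge0.
  have w2 : (1 - u x ^+ n) ^+ M <= 1 by rewrite exprn_ile1//; lra.
  by rewrite /P; lra.
have perP x (z : int) : P (x + z%:~R) = P x.
  by rewrite /P /u addrAC tcosDz.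
exists P; split => //.
- have t1 := trig_poly_cst (1 : R).
  have tu : trig_poly (fun x _ : R => u x).
    apply: eq_trig_poly (trig_lin 2^-1 2^-1 t1 (trig_char 1 0 (- c))) => x y.
    by rewrite /u mulr1 mul1r mul0r addr0; field.
  apply: eq_trig_poly (trig_lin 1 (-1) t1 (trig_polyX M (trig_lin 1 (-1) t1 (trig_polyX n tu)))).
  by move=> x y; rewrite /P !mul1r !mulN1r.
- move=> x hx; apply: (le_trans ((hM _ (u01 x)).1 _)); last by rewrite ge_min lexx.
  (* A nearest integer to [x - c]: the remaining distance is at most [2^-1], where [tcos]
     decreases. *)
  pose z := Num.floor (x - c + 2^-1).
  have z1 := floor_le_tmp (x - c + 2^-1); have z2 := floorD1_gt (x - c + 2^-1).
  rewrite intrD -/z in z2; rewrite -/z in z1.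
  have rt : r <= `|x - c - z%:~R|.
    rewrite leNgt; apply/negP; rewrite ltr_norml /r /c => /andP[h1 h2].
    by apply: (hx z); apply/andP; split; lra.
  have t2 : `|x - c - z%:~R| <= 2^-1 by rewrite ler_norml; apply/andP; split; lra.
  have := ler_tcos _ rt t2; rewrite tcos_norm -mulrNz tcosDz /u.
  have r0 : 0 <= r by lra.
  by move=> /(_ r0); lra.
pose K := (Num.truncn ((2 * r' - rho) / 2)^-1).+1.
have K0 : 0 < K%:R :> R by rewrite ltr0n.
have K1 : K%:R^-1 <= (2 * r' - rho) / 2.
  by rewrite invf_ple// ltW// truncnS_gt.
exists K => // x.
have in_ge y : c - r' <= y <= c - r' + 2 * r' -> 1 - e <= P y.
  move=> hy; rewrite /P lerD2l lerN2; apply: (hM _ (u01 y)).2.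
  have h1 : `|y - c| <= r' by rewrite ler_norml; apply/andP; split; lra.
  have := ler_tcos (normr_ge0 _) h1 (le_trans (ltW r'r) r2).
  by rewrite tcos_norm /u; lra.
have e1 : e <= (2 * r' - rho) / 2 by rewrite ge_min lexx orbT.
have e2 : 0 <= 1 - e by lra.
have w1 : 0 <= 2 * r' <= 1 by apply/andP; split; lra.
have P0 y : 0 <= P y by case/andP: (P01 y).
apply: le_trans (grid_avg_ge (K := K) isT perP P0 e2 w1 in_ge x).
have := invr_ge0 (K%:R : R); rewrite (ltW K0) => K2.
by nra.
Qed.

Definition vanishing_mean (s : nat -> R) :=
  (fun N => (\sum_(n < N) s n) / N%:R) @ \oo --> (0 : R).

Lemma vanishing_mean0 : vanishing_mean (fun=> 0).
Proof.
rewrite /vanishing_mean (_ : (fun _ => _) = cst 0); first exact: cvg_cst.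
by apply/funext => N; rewrite big1// mul0r.
Qed.

Lemma vanishing_mean_lin (a b : R) s t : vanishing_mean s -> vanishing_mean t ->
  vanishing_mean (fun n => a * s n + b * t n).
Proof.
move=> vs vt; rewrite /vanishing_mean.
rewrite (_ : (fun _ => _) = (fun N => a * ((\sum_(n < N) s n) / N%:R) +
    b * ((\sum_(n < N) t n) / N%:R))); last first.
  by apply/funext => N; rewrite big_split/= -!mulr_sumr mulrDl !mulrA.
rewrite -[X in _ --> X](_ : a * 0 + b * 0 = 0); last by rewrite !mulr0 addr0.
by apply: cvgD; apply: cvgM => //; exact: cvg_cst.
Qed.

Lemma vanishing_mean_sum (s : nat -> nat -> R) K : (forall i, vanishing_mean (s i)) ->
  vanishing_mean (fun n => \sum_(i < K) s i n).
Proof.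
move=> vs; elim: K => [|K IH].
  by under eq_fun do rewrite big_ord0; exact: vanishing_mean0.
have := vanishing_mean_lin 1 1 IH (vs K).
rewrite (_ : (fun _ => _) = (fun n => \sum_(i < K.+1) s i n))//.
by apply/funext => n; rewrite big_ord_recr/= !mul1r.
Qed.

(* Translations only rephase a nontrivial character, so its averages vanish
   before and after; the trivial one is invariant. *)
Lemma weyl_shift (x y : nat -> R) F u v : weyl x y -> trig_poly F ->
  vanishing_mean (fun n => F (x n + u) (y n + v) - F (x n) (y n)).
Proof.
move=> W; elim=> [h k phi|a b F1 F2 _ IH1 _ IH2]; last first.
  have := vanishing_mean_lin a b IH1 IH2; congr vanishing_mean.
  by apply/funext => n; ring.
have [hk|hk] := eqVneq (h, k) (0, 0).
  case: hk => -> ->.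
  have := vanishing_mean0; congr vanishing_mean.
  by apply/funext => n; rewrite !mul0r subrr.
have Wk psi : vanishing_mean (fun n => tcos (h%:~R * x n + k%:~R * y n + psi)) := W h k psi hk.
have := vanishing_mean_lin 1 (-1) (Wk (h%:~R * u + k%:~R * v + phi)) (Wk phi).
congr vanishing_mean; apply/funext => n; rewrite mul1r mulN1r; congr (tcos _ - _).
by ring.
Qed.

(** The integer [z] is free, not the floor of [x], so that an interval may cross an integer. *)
Definition in_mod1 (a b x : R) : Prop := exists z : int, a < x - z%:~R < b.

(** A product of two bumps exceeds the indicator of the box by at most a small error, and its mean
    is asymptotically that of its grid average, which is large at every point. *)
Lemma weyl_box_frequency (x y : nat -> R) (a1 b1 a2 b2 kappa : R) : weyl x y ->
  a1 < b1 <= a1 + 1 -> a2 < b2 <= a2 + 1 -> 0 <= kappa ->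
  kappa < (b1 - a1) * (b2 - a2) ->
  exists N0 : nat, forall N, (N0 <= N)%N ->
    kappa * N%:R <= \sum_(n < N) (`[< in_mod1 a1 b1 (x n) /\ in_mod1 a2 b2 (y n) >])%:R.
Proof.
move=> W /andP[ab1 ba1] /andP[ab2 ba2] k0 kl.
(* The deficit [g] pays for three errors of at most [g / 4]: the two bump averages together, the
   values outside the box, and the passage to the limit. *)
pose l1 := b1 - a1; pose l2 := b2 - a2; pose g := l1 * l2 - kappa.
have l10 : 0 < l1 by rewrite subr_gt0.
have l20 : 0 < l2 by rewrite subr_gt0.
have l11 : l1 <= 1 by rewrite /l1; lra.
have l21 : l2 <= 1 by rewrite /l2; lra.
have g0 : 0 < g by rewrite subr_gt0.
have gl1 : g <= l1 by rewrite /g; nra.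
have gl2 : g <= l2 by rewrite /g; nra.
have := @interval_bump a1 b1 (l1 - g / 8) (g / 4) ab1 ba1.
case; [by lra|by rewrite -/l1; lra|by lra|move=> P [tP P01 Pout [K1 K10 Pavg]]].
have := @interval_bump a2 b2 (l2 - g / 8) (g / 4) ab2 ba2.
case; [by lra|by rewrite -/l2; lra|by lra|move=> Q [tQ Q01 Qout [K2 K20 Qavg]]].
have tF := trig_polyM tP (trig_poly_swap tQ).
have V : vanishing_mean (fun n =>
    ((\sum_(i < K1) P (x n + i%:R / K1%:R)) / K1%:R) *
    ((\sum_(j < K2) Q (y n + j%:R / K2%:R)) / K2%:R) - P (x n) * Q (y n)).
  pose D (i j n : nat) :=
    P (x n + i%:R / K1%:R) * Q (y n + j%:R / K2%:R) - P (x n) * Q (y n).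
  have vD i j : vanishing_mean (D i j) := weyl_shift _ _ W tF.
  have vS : vanishing_mean (fun n => \sum_(i < K1) \sum_(j < K2) D i j n).
    apply: (@vanishing_mean_sum (fun i n => \sum_(j < K2) D i j n)) => i.
    exact: vanishing_mean_sum (vD i).
  have := vanishing_mean_lin (K1%:R * K2%:R)^-1 0 vS vanishing_mean0.
  congr vanishing_mean; apply/funext => n; rewrite mul0r addr0.
  under eq_bigr do rewrite sumrB.
  rewrite sumrB !sumr_const !card_ord.
  rewrite -[\sum_(i < K1) \sum_(j < K2) _]big_distrlr/=.
  rewrite -mulrnA -[_ *+ (_ * _)]mulr_natr natrM.
  have k10 : (K1%:R : R) != 0 by rewrite pnatr_eq0 -lt0n.
  have k20 : (K2%:R : R) != 0 by rewrite pnatr_eq0 -lt0n.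
  by field; rewrite k10 k20.
have g4 : 0 < g / 4 by lra.
move/cvgrPdist_le : V => /(_ _ g4) [N0 _ hN0].
exists N0.+1 => N N0N.
have N1 : 0 < N%:R :> R by rewrite ltr0n (leq_ltn_trans _ N0N).
have := hN0 N (ltnW N0N).
rewrite /= sub0r normrN ler_norml => /andP[_].
rewrite ler_pdivrMr// sumrB => h.
have hlow : (l1 - g / 8) * (l2 - g / 8) * N%:R <= \sum_(n < N)
   ((\sum_(i < K1) P (x n + i%:R / K1%:R)) / K1%:R) *
    ((\sum_(j < K2) Q (y n + j%:R / K2%:R)) / K2%:R).
  rewrite mulr_natr -[X in _ *+ X]card_ord -sumr_const; apply: ler_sum => n _.
  by apply: ler_pM => //; lra.
have hup : \sum_(n < N) P (x n) * Q (y n) <= \sum_(n < N)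
    (`[< in_mod1 a1 b1 (x n) /\ in_mod1 a2 b2 (y n) >])%:R + g / 4 * N%:R.
  rewrite mulr_natr -[X in _ *+ X]card_ord -sumr_const -big_split/=; apply: ler_sum => n _.
  have /andP[p0 p1] := P01 (x n); have /andP[q0 q1] := Q01 (y n).
  case: asboolP => /= [_|nb]; first by nra.
  have [hx|/forallNP hx] := pselect (in_mod1 a1 b1 (x n)); last first.
    by have := Pout _ hx; nra.
  have [hy|/forallNP hy] := pselect (in_mod1 a2 b2 (y n)); first by case: nb.
  by have := Qout _ hy; nra.
have main : kappa + g / 4 + g / 4 <= (l1 - g / 8) * (l2 - g / 8).
  have -> : kappa = l1 * l2 - g by rewrite /g; ring.
  move: (l1) (l2) (g) g0 l11 l21 => p q t t0 p1 q1.
  have tp : t * p <= t by rewrite ler_piMr// ltW.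
  have tq : t * q <= t by rewrite ler_piMr// ltW.
  have tt : 0 <= t * t by rewrite mulr_ge0// ltW.
  by rewrite mulrBl !mulrBr; lra.
have := le_trans (ler_wpM2r (ltW N1) main) hlow; rewrite 2!mulrDl => hm.
by lra.
Qed.
End Equidistribution.

(** * Triples from Pell solutions *)

Section Triples.
Variable R : realType.

(** An interval inside [[0, 1]] leaves the floor as the only possible integer. *)
Lemma in_mod1_truncn (a b x : R) : 0 <= a -> b <= 1 -> 0 <= x -> in_mod1 a b x ->
  a < x - (Num.truncn x)%:R < b.
Proof.
move=> a0 b1 x0 [z /andP[az zb]].
suff -> : (Num.truncn x)%:R = z%:~R :> R by rewrite az.
have := truncn_itv x0 => /andP[h1 h2].
case: (z =P Posz (Num.truncn x)) => [->//|zt]; exfalso.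
have e1 : z%:~R < (Num.truncn x).+1%:Z%:~R :> R by rewrite -pmulrn; lra.
have e2 : (Num.truncn x)%:Z%:~R < (z + 1)%:~R :> R by rewrite -pmulrn intrD; lra.
by move: e1 e2; rewrite !ltr_int; lia.
Qed.

Lemma floor_sqE (alpha : R) p k : 0 <= alpha ->
  k%:R <= alpha * p%:R ^+ 2 < k%:R + 1 -> floor_sq alpha p = k.
Proof.
move=> a0 /andP[h1 h2]; apply/eqP.
by rewrite /floor_sq truncn_eq ?mulr_ge0 ?exprn_ge0// h1 -natr1.
Qed.

(* With [b = d - 1] and [e = d + 1], the identities [c^2 = 2 a^2 - 1],
   [b^2 = d^2 - a^2 + 2] and [e^2 = d^2 + a^2] turn every condition on the
   floors into one on the fractional parts [x] of [alpha a^2] and [y] of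
   [alpha d^2]: [0 <= 2 x - alpha < 1], [0 <= y - x + 2 alpha < 1], [x + y < 1]. *)
Lemma pell_floor_sq (alpha a0 a1 : R) n : (0 < n)%N -> 0 < alpha < 1 ->
  alpha / 2 <= a0 -> a0 + a1 <= 2 * alpha -> a1 <= (1 + alpha) / 2 -> a0 <= 2 * alpha ->
  in_mod1 a0 a1 (alpha * (pell_a n)%:R ^+ 2) ->
  in_mod1 0 (1 + a0 - 2 * alpha) (alpha * (pell_d n)%:R ^+ 2) ->
  let k := floor_sq alpha (pell_a n) in
  let m := floor_sq alpha (pell_d n).-1 in
  [/\ floor_sq alpha (pell_c n) = (k + k)%N,
      floor_sq alpha (pell_d n) = (k + m)%N &
      floor_sq alpha (pell_d n).+1 = (k + k + m)%N].
Proof.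
move=> n0 /andP[al0 al1] a0l a01 a1l a0u hx hy k m.
have d0 : (0 < pell_d n)%N by apply: leq_trans (leq_pell_d n).
have dE : (pell_a n)%:R ^+ 2 = 2 * (pell_d n)%:R + 1 :> R.
  by rewrite -natrX pell_dE natrD natrM.
have cE : (pell_c n)%:R ^+ 2 = 2 * (pell_a n)%:R ^+ 2 - 1 :> R.
  by rewrite -!natrX -natrM -pell_eq natrD addrK.
have bE : (pell_d n).-1%:R = (pell_d n)%:R - 1 :> R.
  by rewrite -[in RHS](prednK d0) -natr1 addrK.
have xge : 0 <= alpha * (pell_a n)%:R ^+ 2 by rewrite mulr_ge0 ?exprn_ge0// ltW.
have yge : 0 <= alpha * (pell_d n)%:R ^+ 2 by rewrite mulr_ge0 ?exprn_ge0// ltW.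
have /andP[x1 x2] : a0 < alpha * (pell_a n)%:R ^+ 2 - k%:R < a1.
  by apply: in_mod1_truncn => //; lra.
pose l := floor_sq alpha (pell_d n).
have /andP[y1 y2] : 0 < alpha * (pell_d n)%:R ^+ 2 - l%:R < 1 + a0 - 2 * alpha.
  by apply: in_mod1_truncn => //; lra.
have bsq : alpha * (pell_d n).-1%:R ^+ 2 =
    alpha * (pell_d n)%:R ^+ 2 - alpha * (pell_a n)%:R ^+ 2 + 2 * alpha.
  by rewrite bE dE; ring.
(* Subtraction of naturals truncates, so this comes before [mE]. It holds because
   [alpha * (d - 1) ^ 2] is nonnegative and the box keeps [y - x + 2 * alpha] below 1. *)
have kl : (k <= l)%N.
  have : 0 <= alpha * (pell_d n).-1%:R ^+ 2 by rewrite mulr_ge0 ?exprn_ge0// ltW.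
  rewrite bsq => b0.
  by rewrite -ltnS -(ltr_nat R) -natr1; lra.
have mE : m = (l - k)%N.
  by apply: floor_sqE; [exact: ltW|rewrite bsq natrB//; apply/andP; split; lra].
split.
- apply: floor_sqE; first exact: ltW.
  by rewrite cE natrD; apply/andP; split; lra.
- by rewrite mE subnKC.
- apply: floor_sqE; first exact: ltW.
  rewrite -addnA mE subnKC// natrD -natr1.
  have -> : alpha * ((pell_d n)%:R + 1) ^+ 2 =
    alpha * (pell_d n)%:R ^+ 2 + alpha * (pell_a n)%:R ^+ 2 by rewrite dE; ring.
  by apply/andP; split; lra.
Qed.

(** Both choices saturate [a0 + a1 <= 2 * alpha]: up to one half [a0] sits at its lower bound
    [alpha / 2], beyond it [a1] sits at its upper bound [(1 + alpha) / 2]. *)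
Lemma pell_box_exists (alpha : R) : 0 < alpha < 1 -> exists a0 a1 : R,
  [/\ [/\ alpha / 2 <= a0, a0 < a1, a0 + a1 <= 2 * alpha & a1 <= (1 + alpha) / 2],
      2 * alpha < 1 + a0, a0 <= 2 * alpha &
      (1 - alpha) * Num.min (1 - alpha) (2 * alpha) / 4
        <= (a1 - a0) * (1 + a0 - 2 * alpha)].
Proof.
move=> /andP[al0 al1]; have [h|h] := lerP alpha 2^-1.
  exists (alpha / 2), (3 * alpha / 2); split; [split| | | ]; try lra.
  apply: (@le_trans _ _ ((1 - alpha) * (2 * alpha) / 4)).
    apply: ler_wpM2r => //; apply: ler_wpM2l; first by lra.
    by rewrite ge_min lexx orbT.
  by nra.
exists ((3 * alpha - 1) / 2), ((1 + alpha) / 2); split; [split| | | ]; try lra.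
apply: (@le_trans _ _ ((1 - alpha) * (1 - alpha) / 4)).
  apply: ler_wpM2r => //; apply: ler_wpM2l; first by lra.
    by rewrite ge_min lexx.
by nra.
Qed.

Lemma admissible_leq (alpha : R) m p : (0 < m)%N -> alpha `^ (- 2^-1) <= m%:R ->
  (m <= p)%N -> admissible alpha p.
Proof.
move=> m0 hm mp; split; first exact: leq_trans mp.
by rewrite (le_trans hm)// ler_nat.
Qed.

Lemma ltn_pell_a_homo m n : (m < n)%N -> (pell_a m < pell_a n)%N.
Proof.
apply: (homo_ltn ltn_trans) => {}n.
by rewrite pell_aS; have := pell_a_le_c n; have := ltn_pell_a n; lia.
Qed.

(** The squares grow by at least [n0 >= alpha^-1], so [alpha * a ^ 2] grows by at least 1. This
    makes the triples of distinct indices distinct. *)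
Lemma ltn_floor_sq_pell (alpha : R) n0 m n : 0 < alpha -> alpha^-1 <= n0%:R ->
  (n0 <= m)%N -> (m < n)%N ->
  (floor_sq alpha (pell_a m) < floor_sq alpha (pell_a n))%N.
Proof.
move=> al0 hn0 nm mn; rewrite /floor_sq.
have ge0 p : 0 <= alpha * p%:R ^+ 2 :> R by rewrite mulr_ge0 ?exprn_ge0// ltW.
rewrite truncn_ge_nat// -natr1.
have h1 : (Num.truncn (alpha * (pell_a m)%:R ^+ 2))%:R <= alpha * (pell_a m)%:R ^+ 2.
  by rewrite truncn_le.
have h2 : (pell_a m ^ 2 + n0 <= pell_a n ^ 2)%N.
  by have := ltn_pell_a_homo mn; have := ltn_pell_a m; nia.
have h3 : (pell_a m)%:R ^+ 2 + n0%:R <= (pell_a n)%:R ^+ 2 :> R.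
  by rewrite -!natrX -natrD ler_nat.
have h4 : 1 <= alpha * n0%:R by rewrite mulrC -ler_pdivrMr// mul1r.
have := ler_wpM2l (ltW al0) h3; rewrite mulrDr; lra.
Qed.

Lemma pell_a_le_predd n : (1 < n)%N -> (pell_a n <= (pell_d n).-1)%N.
Proof. by have := ltn_pell_a n; have := pell_dE n; nia. Qed.

Lemma pell_triples_count (alpha kappa : R) : 0 < alpha < 1 ->
  weyl (fun n => alpha * (pell_a n)%:R ^+ 2) (fun n => alpha * (pell_d n)%:R ^+ 2) ->
  0 <= kappa -> kappa < (1 - alpha) * Num.min (1 - alpha) (2 * alpha) / 4 ->
  exists N0 : nat, forall (N : nat) (x : R), (N0 <= N)%N ->
    (forall n, (n < N)%N -> (pell_d n)%:R <= x) ->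
    kappa * N%:R <= (#|` fset_set (T_le alpha x)|)%:R.
Proof.
move=> al W k0 kl; have /andP[al0 al1] := al.
have [a0 [a1 [[h1 h2 h3 h4] h5 h6 harea]]] := pell_box_exists al.
set area := (a1 - a0) * _ in harea.
(* The gap between [kappa] and [kappa'] absorbs the at most [n0] discarded small indices once
   [N >= N2]. *)
pose kappa' := (kappa + area) / 2.
have kk' : kappa < kappa' by rewrite /kappa'; lra.
have k'a : kappa' < (a1 - a0) * (1 + a0 - 2 * alpha - 0) by rewrite subr0 -/area /kappa'; lra.
have i1 : a0 < a1 <= a0 + 1 by apply/andP; split; lra.
have i2 : 0 < 1 + a0 - 2 * alpha <= 0 + 1 by apply/andP; split; lra.
have k'0 : 0 <= kappa' by lra.
have [N1 hN1] := weyl_box_frequency W i1 i2 k'0 k'a.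
(* The three bounds serve [a <= d - 1], hence [k <= m]; positive and distinct floors; and
   admissibility. *)
pose n0 := maxn 2 (maxn (Num.truncn alpha^-1).+1 (Num.truncn (alpha `^ (- 2^-1))).+1).
have n02 : (2 <= n0)%N by rewrite leq_maxl.
have n0i : alpha^-1 <= n0%:R.
  rewrite (le_trans (ltW (truncnS_gt _)))// ler_nat.
  by rewrite (leq_trans _ (leq_maxr _ _))// leq_maxl.
have n0s : alpha `^ (- 2^-1) <= n0%:R.
  rewrite (le_trans (ltW (truncnS_gt _)))// ler_nat.
  by rewrite (leq_trans _ (leq_maxr _ _))// leq_maxr.
clearbody n0.
pose N2 := (Num.truncn (n0%:R / (kappa' - kappa))).+1.
have hN2 : n0%:R / (kappa' - kappa) <= N2%:R by rewrite ltW// truncnS_gt.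
exists (maxn N1 N2) => N x; rewrite geq_max => /andP[NN1 NN2] hx.
pose good n := `[< in_mod1 a0 a1 (alpha * (pell_a n)%:R ^+ 2) /\
  in_mod1 0 (1 + a0 - 2 * alpha) (alpha * (pell_d n)%:R ^+ 2) >].
pose s := [seq n <- iota 0 N | (n0 <= n)%N && good n].
pose f n := (floor_sq alpha (pell_a n), floor_sq alpha (pell_a n), floor_sq alpha (pell_d n).-1).
have sz : (\sum_(n < N) good n <= size s + n0)%N.
  have -> : size s = (\sum_(n < N) ((n0 <= n) && good n))%N.
    rewrite size_filter -sum1_count big_mkcond/=
      -(big_mkord xpredT (fun n => nat_of_bool ((n0 <= n)%N && good n))).
    by rewrite /index_iota subn0; apply: eq_bigr => i _; case: (_ && _).
  apply: leq_trans (leq_add (leqnn _) (sum_ltn_le n0 N)).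
  rewrite -big_split/=; apply: leq_sum => i _.
  by case: (good i); case: ltnP.
clearbody N2 kappa' area.
have size_le : (size s <= #|` fset_set (T_le alpha x)|)%N.
  rewrite -(size_map f); apply: uniq_leq_size.
    rewrite map_inj_in_uniq ?filter_uniq ?iota_uniq// => m n.
    rewrite !mem_filter => /andP[/andP[nm _] _] /andP[/andP[nn _] _] [fE _ _].
    apply/eqP; case: ltngtP => // mn.
    - by have := ltn_floor_sq_pell al0 n0i nm mn; rewrite fE ltnn.
    - by have := ltn_floor_sq_pell al0 n0i nn mn; rewrite fE ltnn.
  move=> _ /mapP[n + ->]; rewrite mem_filter mem_iota add0n => /andP[/andP[nn /asboolP[hX hY]] nN].
  rewrite in_fset_set; last exact: finite_T_le.
  apply/mem_set.
  have n2 : (1 < n)%N := leq_trans n02 nn.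
  have n1 : (0 < n)%N := ltnW n2.
  have [cE dE eE] := pell_floor_sq n1 al h1 h3 h4 h6 hX hY.
  have nn0 : (0 < n0)%N := ltnW n02.
  have adm p : (n <= p)%N -> admissible alpha p.
    by move=> np; apply: (admissible_leq nn0 n0s); exact: leq_trans np.
  have la := ltnW (ltn_pell_a n); have lac := leq_trans la (pell_a_le_c n).
  have ab := pell_a_le_predd n2; have ad := leq_trans ab (leq_pred _).
  have lb := leq_trans la ab; have ld := leq_trans la ad.
  have ax : (pell_a n)%:R <= x by rewrite (le_trans _ (hx _ nN))// ler_nat.
  have bx : (pell_d n).-1%:R <= x by rewrite (le_trans _ (hx _ nN))// ler_nat leq_pred.
  have Sf p : (n <= p)%N -> S_ alpha (floor_sq alpha p) by move=> np; exists p => //; exact: adm.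
  (* Only the indices [a], [a], [d - 1] of the components must be at most [x]; those of the sums, up
     to [d + 1], need not be. *)
  split; last first.
    by exists (pell_a n), (pell_a n), (pell_d n).-1; split => //; split => //; exact: adm.
  split; last split.
  - split => //.
      rewrite /floor_sq truncn_gt0.
      have a0s : alpha^-1 <= (pell_a n)%:R ^+ 2.
        by rewrite (le_trans n0i)// -natrX ler_nat (leq_trans nn)// (leq_trans la)//
           leq_pmulr// (leq_ltn_trans _ (ltn_pell_a n)).
      by have := ler_wpM2l (ltW al0) a0s; rewrite mulfV// lt0r_neq0.
    by rewrite /floor_sq le_truncn// ler_wpM2l ?(ltW al0)// lerXn2r ?nnegrE// ler_nat.
  - by split; apply: Sf.
  - by split; [rewrite -cE|rewrite -dE|rewrite addnC -dE|rewrite -eE];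
      apply: Sf => //; exact: leqW.
have h := hN1 _ NN1.
have h' : \sum_(n < N) (good n)%:R <= (size s)%:R + n0%:R :> R.
  by rewrite -natr_sum -natrD ler_nat.
have h'' : n0%:R <= (kappa' - kappa) * N%:R.
  rewrite mulrC -ler_pdivrMr ?subr_gt0// (le_trans hN2)//.
  by rewrite ler_nat.
have h3' : (size s)%:R <= (#|` fset_set (T_le alpha x)|)%:R :> R by rewrite ler_nat.
by apply: le_trans h3'; move: h h' h''; rewrite /good mulrBl; lra.
Qed.

(** The number [c + a * sqrt 2] is the power [2 * n + 1] of [1 + sqrt 2] and bounds [a]; then
    [d <= a ^ 2] doubles the exponent. *)
Lemma pell_d_le (n N : nat) : (n < N)%N ->
  (pell_d n)%:R <= (1 + Num.sqrt 2) ^+ (4 * N) :> R.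
Proof.
move=> nN; set r := Num.sqrt 2.
have r2 : r ^+ 2 = 2 by rewrite sqr_sqrtr.
have r0 : 0 <= r by exact: sqrtr_ge0.
have r1 : 1 <= r by rewrite -(@sqrtr1 R) ler_wsqrtr// ler1n.
have E : (pell_c n)%:R + (pell_a n)%:R * r = (1 + r) ^+ (2 * n).+1.
  elim: n {nN} => [|n IH]; first by rewrite mul1r expr1.
  have -> : (pell_c n.+1)%:R = 3 * (pell_c n)%:R + 4 * (pell_a n)%:R :> R.
    by rewrite pell_cS natrD !natrM.
  have -> : (pell_a n.+1)%:R = 2 * (pell_c n)%:R + 3 * (pell_a n)%:R :> R.
    by rewrite pell_aS natrD !natrM.
  rewrite mulnS !addSn exprS exprS -IH.
  apply/eqP; rewrite -subr_eq0.
  rewrite (_ : _ - _ = (2 - r ^+ 2) * ((pell_c n)%:R + 2 * (pell_a n)%:R + (pell_a n)%:R * r)).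
    by rewrite r2 subrr mul0r.
  by ring.
have ale : (pell_a n)%:R <= (1 + r) ^+ (2 * n).+1.
  rewrite -E; have : (pell_a n)%:R * 1 <= (pell_a n)%:R * r by rewrite ler_wpM2l.
  by have := ler0n R (pell_c n); lra.
apply: (@le_trans _ _ ((pell_a n)%:R ^+ 2)).
  by rewrite -natrX ler_nat pell_dE; lia.
apply: (@le_trans _ _ (((1 + r) ^+ (2 * n).+1) ^+ 2)).
  by rewrite lerXn2r ?nnegrE ?exprn_ge0 ?addr_ge0.
by rewrite -exprM ler_weXn2l//; [lra|lia].
Qed.

(** About [ln x / (4 * L)] indices at frequency [C / 4] give [C * ln x / (16 * L)]; for large [x]
    the [eps] absorbs [ln 16] and the rounding. *)
Lemma pell_log_count (alpha s t eps : R) : 0 < s -> s < alpha < t -> t < 1 -> 0 < eps ->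
  weyl (fun n => alpha * (pell_a n)%:R ^+ 2) (fun n => alpha * (pell_d n)%:R ^+ 2) ->
  exists2 x0 : R, 1 < x0 & forall x : R, x0 <= x ->
    (1 - t) * Num.min (1 - t) (2 * s) *
      (ln (16 * x) / (16 * ln (1 + Num.sqrt 2) + eps))
    <= (#|` fset_set (T_le alpha x)|)%:R.
Proof.
move=> s0 /andP[sa at_] t1 e0 W.
have al : 0 < alpha < 1 by apply/andP; split; lra.
set C := (1 - t) * _.
have C0 : 0 < C by rewrite mulr_gt0// ?subr_gt0// lt_min; apply/andP; split; lra.
(* Strict since [alpha < t], which leaves [C / 4] below the attainable frequency. *)
have Clt : C < (1 - alpha) * Num.min (1 - alpha) (2 * alpha).
  apply: (@lt_le_trans _ _ ((1 - alpha) * Num.min (1 - t) (2 * s))).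
    by rewrite ltr_pM2r; [lra|rewrite lt_min; apply/andP; split; lra].
  rewrite ler_wpM2l//; first lra.
  by rewrite le_min !ge_min; apply/andP; split; apply/orP; [left|right]; lra.
have [||N0 hN0] := @pell_triples_count alpha (C / 4) al W; [lra|lra|].
set L := ln (1 + Num.sqrt 2).
have r1 : 1 < 1 + Num.sqrt 2 :> R by rewrite ltrDl sqrtr_gt0.
have r0 : 0 < 1 + Num.sqrt 2 :> R by exact: lt_trans r1.
have L0 : 0 < L by rewrite ln_gt0.
pose D := 16 * L + eps.
have D0 : 0 < D by rewrite /D; lra.
pose B := ln (16 : R).
(* Solves the final inequality for [ln x]: [4^-1] is the loss from rounding [N] down, [B / D] the
   share of the factor 16. *)
pose T := (4^-1 + B / D) / ((16 * L)^-1 - D^-1).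
have den0 : 0 < (16 * L)^-1 - D^-1.
  by rewrite subr_gt0 ltf_pV2 ?posrE//; rewrite /D; lra.
pose T' := Num.max 1 (Num.max T (4 * L * N0%:R)).
exists (expR T'); first by rewrite expR_gt1 lt_max ltr01.
move=> x hx.
have x0 : 0 < x by rewrite (lt_le_trans _ hx)// expR_gt0.
have hT' : T' <= ln x by rewrite -[leLHS]expRK ler_ln ?posrE ?expR_gt0.
have [hT1 [hT hTN]] : 1 <= ln x /\ T <= ln x /\ 4 * L * N0%:R <= ln x.
  by move: hT'; rewrite !ge_max => /andP[-> /andP[-> ->]].
have L4 : 0 < 4 * L by rewrite mulr_gt0.
pose N := Num.truncn (ln x / (4 * L)).
have y0 : 0 <= ln x / (4 * L) by rewrite divr_ge0 ?ltW//; lra.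
have N1 : N%:R <= ln x / (4 * L) by rewrite truncn_le.
have N2 : ln x / (4 * L) < N%:R + 1 by rewrite natr1 truncnS_gt.
have N0N : (N0 <= N)%N.
  by rewrite truncn_ge_nat// ler_pdivlMr// mulrC.
have hd n : (n < N)%N -> (pell_d n)%:R <= x.
  move=> nN; apply: (le_trans (pell_d_le nN)).
  rewrite -ler_ln ?posrE ?exprn_gt0// lnXn// -/L -[leLHS]mulr_natr natrM.
  by move: N1; rewrite ler_pdivlMr//; lra.
apply: le_trans (hN0 N x N0N hd).
rewrite lnM ?posrE// -/B -/D -(mulrA C 4^-1) ler_pM2l//.
rewrite /T ler_pdivrMr// in hT.
have e1 : ln x / (4 * L) = 4 * (ln x * (16 * L)^-1) by field; lra.
have e2 : (B + ln x) / D = B / D + ln x * D^-1 by rewrite mulrDl.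
rewrite e2.
move: hT N2; rewrite mulrBr e1; lra.
Qed.

Lemma pell_infinite (alpha : R) : 0 < alpha < 1 ->
  weyl (fun n => alpha * (pell_a n)%:R ^+ 2) (fun n => alpha * (pell_d n)%:R ^+ 2) ->
  infinite_set (T_ alpha).
Proof.
move=> al W finT; have /andP[al0 al1] := al.
pose m := (1 - alpha) * Num.min (1 - alpha) (2 * alpha).
have m0 : 0 < m by rewrite mulr_gt0 ?subr_gt0// lt_min; apply/andP; split; lra.
have [||N0 hN0] := @pell_triples_count alpha (m / 8) al W; [lra|rewrite -/m; lra|].
pose B : R := (#|` fset_set (T_ alpha)|)%:R.
pose N := maxn N0 (Num.truncn (B / (m / 8))).+1.
(* Here [x] is the power [4 * N] of [1 + sqrt 2], large enough for the first [N] solutions. *)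
have := hN0 N _ (leq_maxl _ _) (fun n => @pell_d_le n N).
apply/negP; rewrite -ltNge; apply: (@le_lt_trans _ _ B).
  rewrite ler_nat; apply: fsubset_leq_card; apply/fsubsetP => p.
  rewrite !in_fset_set//; last exact: finite_T_le.
  by rewrite !inE => -[].
rewrite mulrC -ltr_pdivrMr; last by lra.
by rewrite (lt_le_trans (truncnS_gt _))// ler_nat leq_maxr.
Qed.

End Triples.

Theorem theorem1p4 (R : realType) :
  (forall s t : R, 0 < s -> s < t -> t < 1 ->
    {ae (@lebesgue_measure R), forall alpha : R, s < alpha < t ->
      forall eps : R, 0 < eps ->
      exists2 x0 : R, 1 < x0 & forall x : R, x0 <= x ->
        (1 - t) * Num.min (1 - t) (2 * s) *
          (ln (16 * x) / (16 * ln (1 + Num.sqrt 2) + eps))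
        <= (#|` fset_set (T_le alpha x)|)%:R}) /\
  {ae (@lebesgue_measure R), forall alpha : R, 0 < alpha < 1 ->
    infinite_set (T_ alpha)}.
Proof.
have in01 (alpha : R) : 0 < alpha < 1 -> `[0%R, 1%R]%classic alpha.
  by move=> /andP[a0 a1]; rewrite /= in_itv/= !ltW.
(* In both claims the exceptional set lies in that of [ae_weyl_pell], whatever [s], [t] and
   [eps]. *)
split=> [s t s0 st t1|]; apply: negligibleS (ae_weyl_pell R) => alpha /= nQ W; apply: nQ.
  move=> sat eps e0; apply: (pell_log_count s0 sat t1 e0); apply: W.
  by apply: in01; move: sat => /andP[sa at_]; apply/andP; split; lra.
by move=> al; apply: pell_infinite al (W (in01 _ al)).
Qed.
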